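(* Let $Q>0$ and let $T$ be a rooted tree with root $o$, having at least one edge, in which every vertex $x\ne o$ belongs to at least two edges. Suppose that $(\partial T,\bar\rho)$ is an Ahlfors $Q$-regular metric space and let $0<\alpha<Q$. Then there exists $Y\subseteq\partial T$ such that $(Y,\bar\rho)$, with the restricted metric, is Ahlfors $\alpha$-regular.
   Context: A tree $T$ is a connected graph without cycles; $T$ also denotes its vertex set. $|x|$ is the number of edges of the geodesic from the root $o$ to the vertex $x$. The boundary $\partial T$ is the set of infinite geodesic rays starting at $o$ (infinite paths from $o$ with no repeated edges). For $\zeta\neq\xi$ in $\partial T$, $\zeta\wedge\xi$ is the last vertex (the one furthest from $o$) common to the two rays, and the metric is $\bar\rho(\zeta,\xi)=2^{-|\zeta\wedge\xi|}$, with $\bar\rho(\zeta,\zeta)=0$. For $s>0$, a metric space $(Z,d)$ is Ahlfors $s$-regular if it has at least two points and there are constants $0<c<C$ such that $c\,r^s\le \mathcal{H}^s(B(z,r))\le C\,r^s$ for every $z\in Z$ and $0<r\le \operatorname{diam}(Z)$, $r$ real, where $B(z,r)$ is the metric ball in $Z$ and $\mathcal{H}^s$ is the $s$-dimensional Hausdorff measure, $\mathcal{H}^s(A)=\lim_{\eta\to0}\inf\{\sum_n \operatorname{diam}(U_n)^s:\ A\subseteq\bigcup_n U_n,\ \operatorname{diam}(U_n)\le\eta\}$. *)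

(* Defs.v *)
From HB Require Import structures.
From mathcomp Require Import all_boot all_order all_algebra.
From mathcomp Require Import all_classical all_reals all_analysis.
From mathcomp Require Import zify.
Import Order.TTheory GRing.Theory Num.Theory.

Set Implicit Arguments.
Unset Strict Implicit.
Unset Printing Implicit Defensive.

Local Open Scope classical_set_scope.
Local Open Scope ring_scope.

(* A subset of a metric space, with the restricted metric. The pseudometric
   structure on the type of elements of A is the one of the library, whose balls
   are the preimages of the balls of X. *)
Section subset_metric.
Context {R : realType} {X : metricType R} (A : set X).

Let sdist (x y : set_type A) : R := mdist (set_val x) (set_val y).

Let sdist_ge0 x y : 0 <= sdist x y.
Proof. exact: mdist_ge0. Qed.

Let sdist_positivity x y : sdist x y = 0 -> x = y.
Proof. by move=> /mdist_positivity; apply: val_inj. Qed.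

Let ballEsdist (x : set_type A) d : ball x d = [set y | sdist x y < d].
Proof.
by rewrite {1}/ball /= /initial_ball /= ballEmdist.
Qed.

HB.instance Definition _ := @PseudoMetric_isMetric.Build R (set_type A)
  sdist sdist_ge0 sdist_positivity ballEsdist.

End subset_metric.

Section ahlfors.
Context {R : realType} {Z : metricType R}.
Local Open Scope ereal_scope.

(* The maximum with 0 only matters for the empty set, whose diameter is 0. *)
Definition diam (U : set Z) : \bar R :=
  maxe 0 (ereal_sup [set (mdist x y)%:E | x in U & y in U]).

Definition hausdorff_content (s eta : R) (A : set Z) : \bar R :=
  ereal_inf [set \sum_(0 <= n <oo) poweR (diam (U n)) s | U in
    [set U : (set Z)^nat |
      A `<=` \bigcup_n U n /\ forall n, diam (U n) <= eta%:E]].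

Definition hausdorff_measure (s : R) (A : set Z) : \bar R :=
  lim (hausdorff_content s eta A @[eta --> 0%R^'+]).

End ahlfors.

Definition ahlfors_regular (R : realType) (s : R) (Z : metricType R) : Prop :=
  (exists x y : Z, x <> y) /\
  exists c C : R, [/\ 0 < c, c < C &
    forall (z : Z) (r : R), 0 < r -> (r%:E <= diam [set: Z])%E ->
      ((c * r `^ s)%:E <= hausdorff_measure s (ball z r) <= (C * r `^ s)%:E)%E].

Record rootedTree := RootedTree {
  vertex :> choiceType;
  edge : rel vertex;
  tree_root : vertex;
  edge_sym : symmetric edge;
  edge_irr : irreflexive edge;
  tree_connected : forall x y, exists2 p, path edge x p & last x p = y;
  (* the cycles of a simple graph are its cyclic sequences of at least three
     distinct vertices *)
  tree_acyclic : forall c, cycle edge c -> uniq c -> (size c <= 2)%N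
}.
Arguments edge {r} : rename.
Arguments tree_root : clear implicits.

Section boundary_def.
Variable T : rootedTree.
Local Notation o := (tree_root T).

(* |x| is the least length of a path from o to x. *)
Definition depth (x : T) : nat :=
  xget 0%N [set n | (exists p, [/\ path edge o p, last o p = x & size p = n]) /\
    forall p, path edge o p -> last o p = x -> (n <= size p)%N].

Record ray := Ray {
  ray_val :> nat -> T;
  ray0 : ray_val 0%N = o;
  ray_edge : forall n, edge (ray_val n) (ray_val n.+1);
  (* no edge is repeated; an edge is the unordered pair of its ends *)
  ray_inj : injective (fun n => [set ray_val n; ray_val n.+1])
}.

HB.instance Definition _ := gen_eqMixin ray.
HB.instance Definition _ := gen_choiceMixin ray.

Definition common (zeta xi : ray) : set T := range zeta `&` range xi.

Definition meet (zeta xi : ray) : T :=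
  xget o [set x | common zeta xi x /\
    forall y, common zeta xi y -> (depth y <= depth x)%N].

End boundary_def.

Section tree_theory.
Variable T : rootedTree.
Local Notation o := (tree_root T).
Implicit Types (x y : T) (p q : seq T) (r : nat -> T).

(* walks without backtracking do not meet themselves *)
Lemma walk_inj r n : (forall i, (i < n)%N -> edge (r i) (r i.+1)) ->
  (forall i, (i.+1 < n)%N -> r i <> r i.+2) ->
  forall i j, (i < j <= n)%N -> r i <> r j.
Proof.
move=> re rb i j.
have [k] := ubnP (j - i); elim: k i j => // k IH i j jik /andP[ij jn] rij.
pose c := [seq r l | l <- iota i (j - i)].
have szc : size c = (j - i)%N by rewrite size_map size_iota.
have nthc l : (l < j - i)%N -> nth o c l = r (i + l)%N.
  by move=> lji; rewrite (nth_map 0%N) ?size_iota// nth_iota.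
have uc : uniq c.
  apply/(uniqP o) => a b; rewrite !inE szc => aj bj; rewrite !nthc// => rab.
  case: (ltngtP a b) => [lt|lt|//]; exfalso.
    apply: (IH (i + a)%N (i + b)%N) => //; last first.
      by rewrite ltn_add2l lt /= (leq_trans _ jn)// ltnW// -ltn_subRL.
    by rewrite subnDl (leq_ltn_trans (leq_subr _ _))// (leq_trans bj).
  apply: (IH (i + b)%N (i + a)%N) => //; last first.
    by rewrite ltn_add2l lt /= (leq_trans _ jn)// ltnW// -ltn_subRL.
  by rewrite subnDl (leq_ltn_trans (leq_subr _ _))// (leq_trans aj).
have cc : cycle edge c.
  case: c szc nthc {uc} => // x c' szc nthc; rewrite /cycle.
  apply/(pathP o) => l; rewrite size_rcons => lc.
  have lj : (l < j - i)%N by rewrite -szc.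
  rewrite -rcons_cons nth_rcons /= ltnS.
  have -> : (l <= size c')%N by rewrite -ltnS.
  rewrite nthc// nth_rcons.
  case: ltngtP => lc'.
  - have := nthc l.+1; rewrite -szc /= ltnS => ->//; rewrite addnS.
    by apply: re; rewrite (leq_trans _ jn)// -ltn_subRL.
  - by move: lc; rewrite ltnS leqNgt lc'.
  - have -> : x = r j.
      by have := nthc 0%N; rewrite addn0 rij => <-//; exact: leq_ltn_trans lj.
    have jE : j = (i + l).+1.
      by rewrite -addnS lc' -[(size c').+1]/(size (x :: c')) szc subnKC// ltnW.
    by rewrite [in X in edge _ X]jE; apply: re; rewrite -jE.
have := tree_acyclic cc uc; rewrite szc.
have : (0 < j - i)%N by rewrite subn_gt0.
case ji : (j - i)%N => [//|[|[|//]]] _ _.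
  have jE : j = i.+1 by rewrite -(subnKC (ltnW ij)) ji addn1.
  have := re i; rewrite -jE jn => /(_ isT).
  by rewrite -rij edge_irr.
have jE : j = i.+2 by rewrite -(subnKC (ltnW ij)) ji addn2.
by apply: (rb i); rewrite -jE.
Qed.

Lemma upath_uniq x p q : path edge x p -> uniq (x :: p) ->
  path edge x q -> uniq (x :: q) -> last x p = last x q -> p = q.
Proof.
elim: p x q => [|a p IH] x [|b q] //=.
- move=> _ _ _ /andP[+ _] E.
  by rewrite E mem_last.
- move=> _ /andP[+ _] _ _ E.
  by rewrite -E mem_last.
move=> /andP[xa pa] /andP[xp up] /andP[xb qb] /andP[xq uq] E.
have [ab|ab] := eqVneq a b.
  by rewrite -ab in qb uq E *; congr (_ :: _); apply: (IH a).
exfalso.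
(* the walk from the end of p back to x, then along q *)
have [w wE1] : exists w, w = rev (a :: p) ++ x :: b :: q by eexists.
have wE2 : w = rev (x :: a :: p) ++ b :: q.
  by rewrite wE1 [in RHS]rev_cons cat_rcons.
have pw : sorted edge w.
  rewrite wE2; case rE : (rev (x :: a :: p)) => [|y s].
    by move: (congr1 size rE); rewrite size_rev.
  rewrite /= cat_path; apply/andP; split.
    have : sorted edge (rev (x :: a :: p)).
      rewrite rev_sorted /=; apply/andP; split; first by rewrite edge_sym.
      by rewrite (eq_path (e' := edge))// => u v; rewrite edge_sym.
    by rewrite rE.
  have -> : last y s = x.
    by rewrite -[last y s]/(last x (y :: s)) -rE rev_cons last_rcons.
  by rewrite /= xb.
pose r i := nth o w i; pose n := (size w).-1.
have szw : size w = ((size p).+1 + (size q).+2)%N by rewrite wE1 size_cat size_rev /=.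
have nE : n = ((size p).+1 + (size q).+1)%N by rewrite /n szw addnS.
have H1 i : (i < n)%N -> edge (r i) (r i.+1).
  rewrite /n /r; case: (w) pw => [//|y s] /= /(pathP o) ps ii; exact: ps.
have u1 : uniq (rev (x :: a :: p)) by rewrite rev_uniq /= xp.
have u2 : uniq (x :: b :: q) by rewrite /= xq.
have H2 i : (i.+1 < n)%N -> r i <> r i.+2.
  move=> ii; rewrite /r.
  have [ip|ip] := ltnP i.+2 (size p).+2.
    have e k : (k < (size p).+2)%N -> nth o w k = nth o (rev (x :: a :: p)) k.
      by move=> kp; rewrite wE2 nth_cat size_rev kp.
    have ip0 : (i < (size p).+2)%N by rewrite (ltn_trans _ ip)// ltnW.
    rewrite (e i ip0) (e _ ip).
    move/eqP; rewrite nth_uniq ?size_rev//.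
    by move=> /eqP; clear; lia.
  have e k : (size p < k)%N ->
      nth o w k = nth o (x :: b :: q) (k - (size p).+1)%N.
    by move=> kp; rewrite wE1 nth_cat size_rev /= ltnNge kp.
  have [ip'|ip'] := ltnP (size p) i.
    have ip1 : (size p < i.+2)%N by rewrite (ltn_trans ip')// ltnW.
    rewrite (e i ip') (e _ ip1).
    move/eqP; rewrite nth_uniq//=.
    - by move=> /eqP; move: ip'; clear; lia.
    - by move: ii; rewrite nE; clear; lia.
    - by move: ii; rewrite nE; clear; lia.
  have -> : i = size p by move: ip ip'; clear; lia.
  rewrite (e (size p).+2) ?ltnS ?leqnSn//.
  rewrite wE1 nth_cat size_rev /= ltnSn nth_rev//= subnn /= subSnn /=.
  exact/eqP.
apply: (@walk_inj r n H1 H2 0%N n); first by rewrite leqnn nE addnS.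
rewrite /r /n nth0 nth_last wE1; move: E.
by rewrite last_cat /= => <-; rewrite lastI rev_rcons.
Qed.

Lemma depth_path p : path edge o p -> uniq (o :: p) -> depth (last o p) = size p.
Proof.
move=> pp up; rewrite /depth; apply: xget_unique.
  split; first by exists p.
  move=> q pq lq; case/shortenP: pq lq => q' pq' uq' sq' lq'.
  rewrite (upath_uniq pp up pq' uq') //.
  exact: uniq_leq_size (subseq_uniq (subseq_cons _ _) uq') sq'.
move=> m [[q [pq lq <-]] mq]; apply/eqP; rewrite eqn_leq mq//=.
move: (pq) lq; case/shortenP => q' pq' uq' sq' lq'.
rewrite (upath_uniq pp up pq' uq') //.
exact: uniq_leq_size (subseq_uniq (subseq_cons _ _) uq') sq'.
Qed.

Implicit Types zeta xi : ray T.

Lemma ray_ext zeta xi : (forall n, zeta n = xi n) -> zeta = xi.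
Proof.
case: zeta xi => [f f0 fe fi] [g g0 ge gi] /= /funext fg.
by subst g; congr Ray; exact: Prop_irrelevance.
Qed.

Definition ray_prefix zeta n := [seq zeta i.+1 | i <- iota 0 n].

Lemma ray_prefix_path zeta n : path edge o (ray_prefix zeta n).
Proof.
rewrite /ray_prefix -(ray0 zeta).
have: forall m, path edge (zeta m) [seq zeta i.+1 | i <- iota m n].
  by elim: n => //= n IH m; rewrite ray_edge IH.
exact.
Qed.

Lemma ray_prefix_last zeta n : last o (ray_prefix zeta n) = zeta n.
Proof.
case: n => [|n]; first by rewrite /= ray0.
by rewrite /ray_prefix -[in iota _ _]addn1 iotaD map_cat last_cat /= add0n.
Qed.

Lemma ray_vertex_inj zeta : injective zeta.
Proof.
have H i j : (i < j)%N -> zeta i <> zeta j.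
  move=> ij; apply: (@walk_inj zeta j) => //; last by rewrite ij leqnn.
  - by move=> *; exact: ray_edge.
  - move=> k _ E; have := @ray_inj _ zeta k k.+1.
    by rewrite /= -E setUC => /(_ erefl) /eqP; rewrite -[X in X == _]addn0 -addn1 eqn_add2l.
by move=> i j E; case: (ltngtP i j) => // /H; rewrite E.
Qed.

Lemma ray_prefix_uniq zeta n : uniq (o :: ray_prefix zeta n).
Proof.
have -> : o :: ray_prefix zeta n = [seq zeta i | i <- iota 0 n.+1].
  by rewrite /= ray0 /ray_prefix -[1%N]addn0 iotaDl -map_comp.
by rewrite map_inj_uniq ?iota_uniq//; exact: ray_vertex_inj.
Qed.

Lemma depth_ray zeta n : depth (zeta n) = n.
Proof.
rewrite -ray_prefix_last depth_path ?ray_prefix_path ?ray_prefix_uniq//.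
by rewrite size_map size_iota.
Qed.

Lemma ray_agree zeta xi n k : zeta n = xi n -> (k <= n)%N -> zeta k = xi k.
Proof.
move=> E kn.
have /(congr1 (take k)) : ray_prefix zeta n = ray_prefix xi n.
  apply: (@upath_uniq o); rewrite ?ray_prefix_path ?ray_prefix_uniq//.
  by rewrite !ray_prefix_last.
rewrite /ray_prefix -!map_take !take_iota (minn_idPl kn) => {}E.
by rewrite -2!ray_prefix_last /ray_prefix E.
Qed.

(* the rays zeta and xi agree exactly up to level |zeta /\ xi| *)
Lemma depth_meetP zeta xi : zeta <> xi ->
  forall k, (zeta k = xi k) <-> (k <= depth (meet zeta xi))%N.
Proof.
move=> zx.
have [n nP] : exists n, zeta n != xi n.
  by apply: contrapT => /forallNP H; apply: zx; apply: ray_ext => n; have /negP := H n; rewrite negbK => /eqP.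
have [m mP mmin] := ex_minnP (ex_intro (fun n => zeta n != xi n) n nP).
have m0 : (0 < m)%N by case: m mP {mmin} => //; rewrite !ray0 eqxx.
have agree k : (zeta k = xi k) <-> (k <= m.-1)%N.
  rewrite -ltnS prednK//; split=> [E|km].
    rewrite ltnNge; apply/negP => mk.
    by move: mP; rewrite (ray_agree E mk) eqxx.
  by apply/eqP; apply: contraTT km => /mmin; rewrite -leqNgt.
suff -> : meet zeta xi = zeta m.-1 by rewrite depth_ray.
have cm : common zeta xi (zeta m.-1).
  by split; [exists m.-1|exists m.-1 => //; apply/esym/agree].
have cle y : common zeta xi y -> exists2 k, (k <= m.-1)%N & y = zeta k.
  move=> [[k _ ky] [l _ ly]]; exists k => //; apply/agree.
  have kl : k = l by rewrite -(depth_ray zeta k) ky -ly depth_ray.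
  by rewrite ky kl ly.
apply: xget_unique.
  by split=> // y /cle[k km ->]; rewrite !depth_ray.
move=> y [/cle[k km yk]] /(_ _ cm); rewrite yk !depth_ray => mk.
by congr (ray_val zeta _); apply/eqP; rewrite eqn_leq km mk.
Qed.

End tree_theory.

(* The parameter R makes the real field of the metric part of the type. *)
Definition boundary (R : realType) (T : rootedTree) : Type := ray T.

HB.instance Definition _ (R : realType) (T : rootedTree) :=
  Choice.copy (boundary R T) (ray T).

Definition rho (R : realType) (T : rootedTree) (zeta xi : boundary R T) : R :=
  if zeta == xi then 0 else 2 ^- depth (meet zeta xi).

Section boundary_metric.
Variables (R : realType) (T : rootedTree).
Local Notation rho := (@rho R T).

Let rhoxx zeta : rho zeta zeta = 0.
Proof. by rewrite /rho eqxx. Qed.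

Let rho_positivity zeta xi : rho zeta xi = 0 -> zeta = xi.
Proof.
rewrite /rho; case: eqP => // _ /eqP.
by rewrite invr_eq0 expf_eq0 pnatr_eq0 andbF.
Qed.

Let rho_sym zeta xi : rho zeta xi = rho xi zeta.
Proof. by rewrite /rho eq_sym /meet /common setIC. Qed.

Let rho_triangle xi zeta tau : rho zeta tau <= rho zeta xi + rho xi tau.
Proof.
have ge0 u v : 0 <= rho u v by rewrite /rho; case: eqP => // _; rewrite invr_ge0 exprn_ge0.
have mono (a b : nat) : (a <= b)%N -> (2 ^- b : R) <= 2 ^- a.
  by move=> ab; rewrite lef_pV2 ?posrE ?exprn_gt0// ler_eXn2l// ltr1n.
have [->|zx] := eqVneq zeta xi; first by rewrite rhoxx add0r.
have [->|xt] := eqVneq xi tau; first by rewrite rhoxx addr0.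
have [->|zt] := eqVneq zeta tau; first by rewrite rhoxx addr_ge0.
have [zx' xt' zt'] : [/\ zeta <> xi, xi <> tau & zeta <> tau] by split; apply/eqP.
pose a := depth (meet zeta xi); pose b := depth (meet xi tau).
suff : (minn a b <= depth (meet zeta tau))%N.
  rewrite {1}/rho (negbTE zt) => /mono le; apply: (le_trans le).
  have [ab|ab] := leqP a b.
    by rewrite /rho (negbTE zx) -/a lerDl ge0.
  by rewrite (_ : rho xi tau = 2 ^- b) ?lerDr ?ge0// /rho (negbTE xt).
apply/(depth_meetP zt').
transitivity (ray_val xi (minn a b)).
  by apply/(depth_meetP zx'); rewrite geq_minl.
by apply/(depth_meetP xt'); rewrite geq_minr.
Qed.

HB.instance Definition _ := @isMetric.Build R (boundary R T)
  rho rhoxx rho_positivity rho_sym rho_triangle.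

End boundary_metric.

(* Main.v *)
(** A cover of a cylinder of the boundary by the cylinders k levels below it uses
    at least (c/C) 2^(kQ) of them, by Ahlfors Q-regularity and the subadditivity
    of Hausdorff measure. For k large this is at least 2 * 2^(k alpha), so one can
    select a homogeneous Cantor set Y: every selected cylinder of level n1 + jk
    contains b_j selected cylinders of level n1 + (j+1)k, where the integers
    b_j <= 2 * 2^(k alpha) are chosen so that b_0 ... b_(j-1) stays comparable to
    2^(jk alpha). Covering by the cylinders of one level bounds the
    alpha-measure of a cylinder of Y from above. For the lower bound, give each
    cylinder of order j the weight 1 / (b_0 ... b_(j-1)): cylinders of total
    weight smaller than that of a given one cannot cover it, since a greedy
    descent finds a point that they miss. *)
Require Import Defs.
From mathcomp Require Import all_boot all_order all_algebra.
From mathcomp Require Import all_classical all_reals all_analysis.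
From mathcomp Require Import ring lra.
Import Order.TTheory GRing.Theory Num.Theory.
Local Open Scope classical_set_scope.
Local Open Scope ring_scope.
Set Implicit Arguments.
Unset Strict Implicit.
Unset Printing Implicit Defensive.

(** The set function is abstract because the bound serves twice: for the content at a fixed scale
    and for the Hausdorff measure. *)
Lemma bigcup_subadditive_le (R : realType) (T : Type) (mu : set T -> \bar R)
    n (F : nat -> set T) (K : R) :
  mu set0 = 0%E -> (forall A B, mu (A `|` B) <= mu A + mu B)%E ->
  (forall i, (i < n)%N -> mu (F i) <= K%:E)%E ->
  (mu (\bigcup_(i < n) F i) <= (n%:R * K)%:E)%E.
Proof.
move=> mu0 muU; rewrite bigcup_mkord; elim: n => [|n IH] FK.
  by rewrite big_ord0 mu0 mul0r.
rewrite big_ord_recr /= (le_trans (muU _ _))//.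
rewrite -natr1 mulrDl mul1r EFinD leeD ?FK//.
by apply: IH => i ij; apply: FK; rewrite ltnW.
Qed.

(** * Hausdorff content and measure: monotonicity and subadditivity *)

Section hausdorff.
Context {R : realType} {Z : metricType R}.
Implicit Types (A B U : set Z) (s eta : R).
Local Open Scope ereal_scope.

Lemma diam_ge0 U : 0 <= diam U.
Proof. by rewrite /diam le_max lexx. Qed.

Lemma mdist_le_diam U x y : U x -> U y -> (mdist x y)%:E <= diam U.
Proof.
move=> Ux Uy; rewrite /diam le_max; apply/orP; right.
by apply: ereal_sup_ubound; exists x => //; exists y.
Qed.

Lemma diam_le U (d : R) : (0 <= d)%R ->
  (forall x y, U x -> U y -> (mdist x y <= d)%R) -> diam U <= d%:E.
Proof.
move=> d0 Ud; rewrite /diam ge_max lee_fin d0 /=.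
by apply: ge_ereal_sup => _ [x Ux [y Uy <-]]; rewrite lee_fin Ud.
Qed.

Lemma diam0 : diam (set0 : set Z) = 0.
Proof.
by apply/eqP; rewrite eq_le diam_ge0 andbT; apply: diam_le.
Qed.

(** Merges two covers into one sequence: a partial sum of the alternating series up to [2N] is a sum
    of two partial sums up to [N]. *)
Lemma nneseries_interleave (u v : nat -> \bar R) :
  (forall n, 0 <= u n) -> (forall n, 0 <= v n) ->
  \sum_(n <oo) (if odd n then v n./2 else u n./2) <=
  \sum_(n <oo) u n + \sum_(n <oo) v n.
Proof.
move=> u0 v0; have w0 n : 0 <= (if odd n then v n./2 else u n./2).
  by case: ifP.
apply: lime_le; first exact: is_cvg_nneseries.
apply: nearW => N.
apply: (@le_trans _ _ (\sum_(0 <= n < N.*2)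
    (if odd n then v n./2 else u n./2))).
  by apply: lee_sum_nneg_natr => //; rewrite -addnn leq_addr.
have -> : \sum_(0 <= n < N.*2) (if odd n then v n./2 else u n./2) =
    \sum_(0 <= n < N) u n + \sum_(0 <= n < N) v n.
  elim: N => [|N IH]; first by rewrite !big_geq// adde0.
  rewrite doubleS !big_nat_recr//= IH uphalf_double doubleK odd_double /=.
  by rewrite -!addeA; congr (_ + _); rewrite addeCA.
by apply: leeD; exact: nneseries_lim_ge.
Qed.

Lemma hausdorff_content_ge0 s eta A : 0 <= hausdorff_content s eta A.
Proof.
apply: le_ereal_inf_tmp => _ [U _ <-]; apply: nneseries_ge0 => n _ _.
exact: poweR_ge0.
Qed.

Lemma hausdorff_contentS s eta A B : A `<=` B ->
  hausdorff_content s eta A <= hausdorff_content s eta B.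
Proof.
move=> AB; apply: ereal_inf_le_tmp => _ [U [BU Ue] <-]; exists U => //.
by split=> //; exact: subset_trans BU.
Qed.

Lemma hausdorff_content_anti s A (d e : R) : (d <= e)%R ->
  hausdorff_content s e A <= hausdorff_content s d A.
Proof.
move=> de; apply: ereal_inf_le_tmp => _ [U [AU Ud] <-]; exists U => //.
by split=> // n; rewrite (le_trans (Ud n))// lee_fin.
Qed.

Lemma hausdorff_content_le_diam s eta A : (0 < s)%R -> (0 <= eta)%R ->
  diam A <= eta%:E -> hausdorff_content s eta A <= poweR (diam A) s.
Proof.
move=> s0 e0 Ae; apply: ereal_inf_lbound.
(* The one-set cover is padded with empty sets, which cost 0 because [s > 0]. *)
exists (fun n => if n == 0%N then A else set0); first split.
- by move=> x Ax; exists 0%N.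
- by move=> [|n] //=; rewrite diam0 lee_fin.
rewrite (nneseries_split 0 1); last by move=> *; exact: poweR_ge0.
rewrite add0n big_nat1 /= eseries0 ?adde0//.
by move=> [|n] // _ _; rewrite /= diam0 poweR0r// gt_eqF.
Qed.

Lemma hausdorff_content0 s eta : (0 < s)%R -> (0 <= eta)%R ->
  hausdorff_content s eta (set0 : set Z) = 0.
Proof.
move=> s0 e0; apply/eqP; rewrite eq_le hausdorff_content_ge0 andbT.
apply: (le_trans (hausdorff_content_le_diam s0 e0 _)); first by rewrite diam0.
by rewrite diam0 poweR0r// gt_eqF.
Qed.

Lemma hausdorff_contentU s eta A B :
  hausdorff_content s eta (A `|` B) <=
  hausdorff_content s eta A + hausdorff_content s eta B.
Proof.
(* Near-optimal covers are extracted from finite infima, so infinite contents are settled first. *)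
have [->|Ay] := eqVneq (hausdorff_content s eta A) +oo.
  by rewrite addye ?leey// gt_eqF// (lt_le_trans _ (hausdorff_content_ge0 _ _ _)).
have [->|By] := eqVneq (hausdorff_content s eta B) +oo.
  by rewrite addey ?leey// gt_eqF// (lt_le_trans _ (hausdorff_content_ge0 _ _ _)).
have Af : hausdorff_content s eta A \is a fin_num.
  by rewrite ge0_fin_numE ?hausdorff_content_ge0// ltey.
have Bf : hausdorff_content s eta B \is a fin_num.
  by rewrite ge0_fin_numE ?hausdorff_content_ge0// ltey.
apply/lee_addgt0Pr => e e0.
have e20 : (0 < e / 2)%R by rewrite divr_gt0.
have [_ [U [AU Ue] <-] HU] := lb_ereal_inf_adherent e20 Af.
have [_ [V [BV Ve] <-] HV] := lb_ereal_inf_adherent e20 Bf.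
pose W n := if odd n then V n./2 else U n./2.
apply: (@le_trans _ _ (\sum_(0 <= n <oo) poweR (diam (W n)) s)).
  apply: ereal_inf_lbound; exists W => //; split.
    move=> x [/AU[n _ Ux]|/BV[n _ Vx]].
      by exists n.*2 => //; rewrite /W odd_double doubleK.
    by exists n.*2.+1 => //; rewrite /W /= odd_double /= uphalf_double.
  by move=> n; rewrite /W; case: ifP.
have -> : (fun k => \sum_(0 <= n < k) poweR (diam (W n)) s) =
   (fun k => \sum_(0 <= n < k) if odd n then poweR (diam (V n./2)) s
       else poweR (diam (U n./2)) s).
  by apply/funext => k; apply: eq_bigr => n _; rewrite /W; case: ifP.
apply: (le_trans (@nneseries_interleave (fun n => poweR (diam (U n)) s)
   (fun n => poweR (diam (V n)) s) _ _)) => [n|n|]; try exact: poweR_ge0.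
rewrite (splitr e) EFinD addeACA.
by apply: leeD; apply: ltW.
Qed.

(** Smaller scales admit fewer covers, so the content grows as [eta] decreases and its right limit
    at 0 is a supremum. *)
Lemma hausdorff_measureE s A :
  hausdorff_measure s A =
  ereal_sup [set hausdorff_content s eta A | eta in [set eta : R | 0 < eta]%R].
Proof.
have /cvg_lim := @nonincreasing_at_right_cvge R
  (fun eta => hausdorff_content s eta A) 0%R (BInfty R false) isT
  (fun d e _ _ de => hausdorff_content_anti s A de).
rewrite /hausdorff_measure => ->//; congr ereal_sup.
by apply/seteqP; split=> _ [e +] <-; rewrite /= ?in_itv/= ?andbT => e0;
  exists e => //=; rewrite ?in_itv/= ?andbT.
Qed.

Lemma hausdorff_content_le_measure s eta A : (0 < eta)%R ->
  hausdorff_content s eta A <= hausdorff_measure s A.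
Proof.
by move=> e0; rewrite hausdorff_measureE; apply: ereal_sup_ubound; exists eta.
Qed.

Lemma hausdorff_measureU s A B :
  hausdorff_measure s (A `|` B) <= hausdorff_measure s A + hausdorff_measure s B.
Proof.
rewrite {1}hausdorff_measureE; apply: ge_ereal_sup => _ [e e0 <-].
by rewrite (le_trans (hausdorff_contentU _ _ _ _))// leeD//;
  exact: hausdorff_content_le_measure.
Qed.

Lemma hausdorff_measureS s A B : A `<=` B ->
  hausdorff_measure s A <= hausdorff_measure s B.
Proof.
move=> AB; rewrite {1}hausdorff_measureE; apply: ge_ereal_sup => _ [e e0 <-].
by rewrite (le_trans (hausdorff_contentS _ _ AB))// hausdorff_content_le_measure.
Qed.

Lemma hausdorff_measure0 s : (0 < s)%R -> hausdorff_measure s (set0 : set Z) = 0.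
Proof.
move=> s0; rewrite hausdorff_measureE.
apply/eqP; rewrite eq_le; apply/andP; split.
  by apply: ge_ereal_sup => _ [e /= e0 <-]; rewrite hausdorff_content0// ltW.
by apply: ereal_sup_ubound; exists 1%R; rewrite /= ?hausdorff_content0.
Qed.

End hausdorff.

(** * Branching numbers and auxiliary estimates on reals and series *)

Lemma homogeneous_digits (R : realType) (q : R) : 0 < q -> q <= 2^-1 ->
  exists b : nat -> nat, forall j, [/\ (0 < b j)%N, (b j)%:R <= 2 / q &
    2^-1 <= (\prod_(i < j) b i)%:R * q ^+ j <= 1].
Proof.
move=> q0 q2.
(* t j is the product in the third clause, and b j the largest integer that keeps
   t j.+1 = t j * q * b j at most 1. *)
pose next t : R := t * q * (Num.truncn (t * q)^-1)%:R.
pose t j := iter j next 1.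
have t0 : t 0%N = 1 by [].
have tS j : t j.+1 = next (t j) by [].
clearbody t.
have tP j : 2^-1 <= t j <= 1.
  elim: j => [|j /andP[tj1 tj2]]; first by rewrite t0 lexx andbT; lra.
  rewrite tS /next.
  (* For [0 < u <= 1/2] the integer part [n] of [1/u] satisfies [1 - u < u * n <= 1], which keeps
     the next product in [[1/2, 1]]. *)
  set u := t j * q; have u0 : 0 < u by rewrite /u; nra.
  have u2 : u <= 2^-1 by rewrite /u; nra.
  have ui0 : 0 <= u^-1 by rewrite invr_ge0 ltW.
  have /andP[l1 l2] := truncn_itv ui0.
  rewrite -natr1 in l2; set n := (Num.truncn _)%:R in l1 l2 *.
  have uu : u * u^-1 = 1 by rewrite divff ?gt_eqF.
  apply/andP; split; nra.
exists (fun j => Num.truncn (t j * q)^-1) => j.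
have /andP[tj1 tj2] := tP j.
set u := t j * q; have u0 : 0 < u by rewrite /u; nra.
have u2 : u <= 2^-1 by rewrite /u; nra.
have ui0 : 0 <= u^-1 by rewrite invr_ge0 ltW.
have uu : u * u^-1 = 1 by rewrite divff ?gt_eqF.
have /andP[l1 l2] := truncn_itv ui0.
split.
- rewrite truncn_gt0; nra.
- apply: (le_trans l1); rewrite /u invfM.
  apply: ler_wpM2r; first by rewrite invr_ge0 ltW.
  by rewrite -[leRHS]invrK lef_pV2 ?posrE ?invr_gt0//; lra.
- suff -> : (\prod_(i < j) Num.truncn (t i * q)^-1)%:R * q ^+ j = t j by [].
  elim: {u u0 u2 ui0 uu l1 l2 tj1 tj2} j => [|j IH].
    by rewrite big_ord0 expr0 mulr1 t0.
  rewrite big_ord_recr tS /next natrM exprSr /=.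
  by set n := (Num.truncn _)%:R; rewrite -IH; ring.
Qed.

Lemma ereal_sum_ge_term (R : realType) (u : nat -> \bar R) n :
  (forall n, 0 <= u n)%E -> (u n <= \sum_(k <oo) u k)%E.
Proof.
move=> u0; apply: le_trans (nneseries_lim_ge n.+1 (fun k _ _ => u0 k)).
by rewrite big_nat_recr//= leeDr// sume_ge0.
Qed.

Lemma expr_small (R : realType) (x e : R) : 0 <= x -> x < 1 -> 0 < e ->
  exists n : nat, x ^+ n < e.
Proof.
move=> x0 x1 e0.
have /cvgr0Pnorm_lt/(_ _ e0)[N _ HN] :
    (fun n : nat => x ^+ n) @ \oo --> (0 : R^o).
  by apply: cvg_expr; rewrite ger0_norm.
by exists N; apply: le_lt_trans (HN N (leqnn N)); exact: ler_norm.
Qed.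

Lemma powR_invX (R : realType) (k : nat) (x e : R) : 0 < x ->
  (x ^- k) `^ e = (x `^ (- e)) ^+ k.
Proof.
move=> x0; have -> : x ^- k = x `^ (- k%:R) by rewrite powRN powR_mulrn// ltW.
rewrite -(powR_mulrn k (powR_ge0 x (- e))) -powRrM -powRrM.
by rewrite mulNr mulrC -mulNr.
Qed.

(** * Regularity of homogeneous Cantor sets, as metric spaces coded by digits *)

Section cantor.
Context {R : realType} {Z : metricType R}.
(** [A z j] is the [j]-th digit of [z], and cylinders of order [j] are closed balls of radius
    [D * lam ^+ j]. There are [P j] of them; since [q] is the [alpha]-th power of [lam], [P_growth]
    makes [P j] comparable to [lam] to the power [- j * alpha]. *)
Variables (A : Z -> nat -> nat) (b : nat -> nat) (alpha D lam q : R).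
Hypotheses (alpha0 : 0 < alpha) (D0 : 0 < D) (lam0 : 0 < lam) (lam1 : lam < 1).
Hypotheses (qE : q = lam `^ alpha) (q2 : q <= 2^-1).
Hypothesis A_lt : forall z j, (A z j < b j)%N.
Hypothesis A_surj : forall s : nat -> nat, (forall j, (s j < b j)%N) ->
  exists z, forall j, A z j = s j.
Hypothesis mdist_A : forall x y j,
  (mdist x y <= D * lam ^+ j) <-> (forall i, (i < j)%N -> A x i = A y i).
Local Notation P j := (\prod_(i < j) b i)%N.
Hypothesis P_growth : forall j, 2^-1 <= (P j)%:R * q ^+ j <= 1.

Let cyl (z : Z) j := [set y | forall i, (i < j)%N -> A z i = A y i].

Let q0 : 0 < q. Proof. by rewrite qE powR_gt0. Qed.

Let q1 : q < 1. Proof. by move: q2; lra. Qed.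

Let Pgt0 j : 0 < (P j)%:R :> R.
Proof.
have /andP[h _] := P_growth j.
have : 0 < (P j)%:R * q ^+ j by apply: lt_le_trans h; rewrite invr_gt0.
by rewrite pmulr_lgt0 // exprn_gt0.
Qed.

Let PS j : (P j.+1)%:R = (P j)%:R * (b j)%:R :> R.
Proof. by rewrite big_ord_recr natrM. Qed.

Let b_gt0 j : (0 < b j)%N.
Proof. by have := Pgt0 j.+1; rewrite PS pmulr_rgt0// ltr0n. Qed.

Let P_mono i j : (i <= j)%N -> (P j)%:R^-1 <= (P i)%:R^-1 :> R.
Proof.
move=> /subnK <-; elim: (j - i)%N => [|k IH]; first by rewrite add0n.
apply: le_trans IH; rewrite lef_pV2 ?posrE// addSn PS ler_peMr//.
by rewrite ler1n.
Qed.

Let invP_le j : (P j)%:R^-1 <= 2 * q ^+ j.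
Proof.
have /andP[h _] := P_growth j.
by rewrite -[leLHS]mul1r ler_pdivrMr//; lra.
Qed.

Let invP_ge j : q ^+ j <= (P j)%:R^-1.
Proof.
have /andP[_ h] := P_growth j.
by rewrite -[leRHS]mul1r ler_pdivlMr// mulrC.
Qed.

Let scaleE j : (D * lam ^+ j) `^ alpha = D `^ alpha * q ^+ j.
Proof.
rewrite powRM ?exprn_ge0 ?(ltW D0) ?(ltW lam0)//; congr (_ * _).
rewrite qE -(powR_mulrn j (ltW lam0)) -(powR_mulrn j (powR_ge0 lam alpha)).
by rewrite -powRrM -powRrM mulrC.
Qed.

Let mdist_le (x y : Z) : mdist x y <= D.
Proof.
have /mdist_A : forall i, (i < 0)%N -> A x i = A y i by [].
by rewrite expr0 mulr1.
Qed.

Let diam_cyl z j : (diam (cyl z j) <= (D * lam ^+ j)%:E)%E.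
Proof.
apply: diam_le; first by rewrite mulr_ge0 ?exprn_ge0 ?(ltW D0) ?(ltW lam0).
by move=> x y zx zy; apply/mdist_A => i ij; rewrite -zx// zy.
Qed.

(** Counts the [P m / P j] cylinders of order [m] inside one of order [j], by induction on [m - j]:
    each cylinder splits into [b j] children. *)
Let content_cyl_le eta m z j : D * lam ^+ m <= eta -> (j <= m)%N ->
  (hausdorff_content alpha eta (cyl z j) <=
    (D `^ alpha * q ^+ m * (P m)%:R / (P j)%:R)%:E)%E.
Proof.
move=> me; have e0 : 0 <= eta.
  by rewrite (le_trans _ me)// mulr_ge0 ?exprn_ge0 ?(ltW D0) ?(ltW lam0).
move=> /subnKC; move: (m - j)%N => k; elim: k j z => [|k IH] j z.
  rewrite addn0 => ->; rewrite mulfK ?gt_eqF// -scaleE -poweR_EFin.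
  apply: (le_trans (hausdorff_content_le_diam _ _ _)) => //.
    by rewrite (le_trans (diam_cyl _ _)).
  apply: gt0_ler_poweR; rewrite ?in_itv/= ?(ltW alpha0)//.
  - by rewrite diam_ge0 leey.
  - by rewrite lee_fin leey mulr_ge0 ?exprn_ge0 ?(ltW D0) ?(ltW lam0).
rewrite addnS -addSn => jk.
(* [u d] is [z] with its [j]-th digit replaced by [d], so it represents the [d]-th child. *)
have [u uP] : exists u : nat -> Z, forall d, (d < b j)%N ->
    forall i, A (u d) i = if i == j then d else A z i.
  have /choice[u uP] : forall d, exists x, (d < b j)%N ->
    forall i, A x i = if i == j then d else A z i.
    move=> d; have [dj|] := ltnP d (b j); last by exists z.
    have [x xP] : exists x, forall i, A x i = if i == j then d else A z i.
      by apply: A_surj => i; case: eqP => [->|].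
    by exists x.
  by exists u.
have -> : D `^ alpha * q ^+ m * (P m)%:R / (P j)%:R =
    (b j)%:R * (D `^ alpha * q ^+ m * (P m)%:R / (P j.+1)%:R).
  rewrite PS; have := Pgt0 j; have : 0 < (b j)%:R :> R by rewrite ltr0n.
  by move=> h1 h2; field; rewrite !gt_eqF.
apply: (@le_trans _ _ (hausdorff_content alpha eta
    (\bigcup_(d < b j) cyl (u d) j.+1))); last first.
  apply: bigcup_subadditive_le => [||d _]; last exact: IH.
    exact: hausdorff_content0.
  exact: hausdorff_contentU.
apply: hausdorff_contentS => y zy; exists (A y j); first exact: A_lt.
move=> i; rewrite ltnS leq_eqVlt uP//; case: eqP => [->//|_ /= ij].
exact: zy.
Qed.

Let hausdorff_cyl_le z j :
  (hausdorff_measure alpha (cyl z j) <= (D `^ alpha / (P j)%:R)%:E)%E.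
Proof.
rewrite hausdorff_measureE; apply: ge_ereal_sup => _ [e /= e0 <-].
have [n nP] := expr_small (ltW lam0) lam1 (divr_gt0 e0 D0).
have me : D * lam ^+ (maxn n j) <= e.
  rewrite mulrC -ler_pdivlMr//; apply: le_trans (ltW nP).
  by rewrite ler_wiXn2l ?(ltW lam0) ?(ltW lam1)// leq_maxl.
apply: (le_trans (content_cyl_le z me (leq_maxr _ _))).
rewrite lee_fin ler_wpM2r ?invr_ge0// -mulrA ler_piMr ?powR_ge0//.
by have /andP[_] := P_growth (maxn n j); rewrite mulrC.
Qed.

(* Greedy descent: among the children of a cylinder one receives less than its
   share of the total weight. *)
Let uncovered_point (w : nat -> nat) (y : nat -> Z) z j :
  (\sum_(n <oo) ((P (w n))%:R^-1)%:E < ((P j)%:R^-1 : R)%:E)%E ->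
  exists2 x, cyl z j x & forall n, ~ cyl (y n) (w n) x.
Proof.
move=> wj.
(* The [n]-th covering cylinder is charged to the cylinder of order [i] at [x] exactly when its
   centre [y n] lies there; [good] means that the total charge is below the share [1 / P i]. *)
pose wt x i n : \bar R := if `[< cyl x i (y n) >] then ((P (w n))%:R^-1)%:E else 0%E.
have wt0 x i n : (0 <= wt x i n)%E.
  by rewrite /wt; case: ifP => // _; rewrite lee_fin invr_ge0.
pose good i x := (\sum_(n <oo) wt x i n < ((P i)%:R^-1)%:E)%E.
have step i x : good i x -> exists x', cyl x i x' /\ good i.+1 x'.
  (* If all [b i] children received at least [1 / P i.+1], the parent would receive at least
     [1 / P i], since a centre lying in the parent lies in exactly one child, that of digit
     [A (y n) i]. *)
  move=> gx; apply: contrapT => /forallNP nx.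
  have [u uP] : exists u : nat -> Z, forall d, (d < b i)%N ->
      forall l, A (u d) l = if l == i then d else A x l.
    have /choice[u uP] : forall d, exists x', (d < b i)%N ->
      forall l, A x' l = if l == i then d else A x l.
      move=> d; have [dj|] := ltnP d (b i); last by exists z.
      have [x' xP] : exists x', forall l, A x' l = if l == i then d else A x l.
        by apply: A_surj => l; case: eqP => [->|].
      by exists x'.
    by exists u.
  have cu d : (d < b i)%N -> cyl x i (u d).
    by move=> di l li; rewrite uP// ltn_eqF.
  have big d : (d < b i)%N ->
      (((P i.+1)%:R^-1)%:E <= \sum_(n <oo) wt (u d) i.+1 n)%E.
    move=> di; rewrite leNgt; apply/negP => h.
    by apply: (nx (u d)); split => //; exact: cu.
  move: gx; rewrite /good ltNge => /negP; apply.
  apply: (@le_trans _ _ (\sum_(0 <= d < b i) \sum_(n <oo) wt (u d) i.+1 n)%E).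
    apply: (@le_trans _ _ (\sum_(0 <= d < b i) ((P i.+1)%:R^-1)%:E)%E); last first.
      by rewrite big_nat [in leRHS]big_nat; apply: lee_sum => d /big.
    rewrite sumEFin lee_fin sumr_const_nat subn0 PS -[leRHS]mulr_natr.
    by rewrite invfM divfK// gt_eqF// ltr0n.
  rewrite -nneseries_sum_nat//; apply: lee_nneseries => [n _ _|n _].
    exact: sume_ge0.
  rewrite /wt; case: asboolP => [xy|xy].
    rewrite (bigD1_seq (A (y n) i)) /= ?mem_index_iota ?iota_uniq ?A_lt//.
    rewrite big_nat_cond [X in (_ + X)%E]big1 ?adde0.
      by case: ifP => // _; rewrite lee_fin invr_ge0.
    move=> d /andP[/andP[_ di] dn]; case: asboolP => // /(_ i (ltnSn i)).
    by rewrite uP// eqxx => /eqP; rewrite (negbTE dn).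
  rewrite big_nat big1// => d /andP[_ di]; case: asboolP => // ux; exfalso.
  by apply: xy => l li; rewrite (cu d di)// ux// ltnW.
have /choice[h hP] : forall ix : nat * Z, exists x', good ix.1 ix.2 ->
    cyl ix.2 ix.1 x' /\ good ix.1.+1 x'.
  move=> [i x]; have [/step[x' ?]|ng] := pselect (good i x); first by exists x'.
  by exists z => /ng.
pose X := fix X l := if l is l'.+1 then h ((j + l')%N, X l') else z.
have gX l : good (j + l)%N (X l).
  elim: l => [|l IH].
    rewrite addn0; apply: le_lt_trans wj; apply: lee_nneseries => // n _.
    by rewrite /wt; case: ifP => // _; rewrite lee_fin invr_ge0.
  by have [_] := hP (_, _) IH; rewrite addnS.
have cX l k : cyl (X l) (j + l)%N (X (l + k)%N).
  elim: k => [|k IH]; first by rewrite addn0 => i.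
  move=> i il; rewrite IH// addnS.
  have [+ _] := hP (_, _) (gX (l + k)%N); apply => /=.
  by rewrite (leq_trans il)// leq_add2l leq_addr.
(* The limit of the descent: digit [i] is final in [X i.+1], whose cylinder has order
   [j + i.+1 > i]. *)
have [x xP] : exists x, forall i, A x i = A (X i.+1) i.
  by apply: A_surj => i; exact: A_lt.
have cx l : cyl (X l) (j + l)%N x.
  move=> i il; rewrite xP; have [li|li] := leqP l i.+1.
    by rewrite (cX l (i.+1 - l)%N)// subnKC.
  have := cX i.+1 (l - i.+1)%N i; rewrite (subnKC (ltnW li)) => ->//.
  by rewrite addnS ltnS leq_addl.
exists x; first by have := cx 0%N; rewrite addn0.
(* If [j <= w n], a cylinder containing [x] has its centre in the good cylinder of order [w n] at
   [X (w n - j)] and overloads it. If [w n < j], it alone weighs at least [1 / P j]. *)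
move=> n cyx; have [jw|wj'] := leqP j (w n).
  have := gX (w n - j)%N; rewrite subnKC// /good ltNge => /negP; apply.
  apply: le_trans (ereal_sum_ge_term n (wt0 _ _)).
  rewrite /wt; case: asboolP => // h'; exfalso; apply: h' => i iw.
  by rewrite cyx//; apply: cx; rewrite subnKC.
move: wj; rewrite ltNge => /negP; apply.
apply: (@le_trans _ _ ((P (w n))%:R^-1)%:E).
  by rewrite lee_fin P_mono// ltnW.
apply: (@ereal_sum_ge_term _ (fun n => ((P (w n))%:R^-1)%:E)) => k.
by rewrite lee_fin invr_ge0.
Qed.

(** With [d] the diameter of [U], take the least [m] such that the [alpha]-th power of
    [D * lam ^+ m.+1] is at most that of [d] plus [e]. Minimality gives [d <= D * lam ^+ m], so one
    cylinder contains [U]. The term [e > 0] ensures that [m] exists when [d = 0]. *)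
Let cover_cyl (U : set Z) (e : R) (z : Z) : 0 < e -> exists m y, U `<=` cyl y m /\
  (((P m)%:R^-1)%:E <= (2 / (q * D `^ alpha))%:E * (poweR (diam U) alpha + e%:E))%E.
Proof.
move=> e0.
have dD : (diam U <= D%:E)%E by apply: diam_le => //; exact: ltW.
have [d [d0 dE]] : exists d, 0 <= d /\ diam U = d%:E.
  have df : diam U \is a fin_num.
    by rewrite ge0_fin_numE ?diam_ge0// (le_lt_trans dD)// ltry.
  by exists (fine (diam U)); rewrite fine_ge0 ?diam_ge0// fineK.
have da0 := powR_ge0 d alpha.
have Da0 : 0 < D `^ alpha by exact: powR_gt0.
have ex : exists m, D `^ alpha * q ^+ m.+1 <= d `^ alpha + e.
  have [n nP] := expr_small (ltW q0) q1 (divr_gt0 e0 Da0).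
  exists n; rewrite mulrC -ler_pdivlMr//; apply: (@le_trans _ _ (q ^+ n)).
    by rewrite ler_wiXn2l ?(ltW q0) ?(ltW q1).
  by apply: (le_trans (ltW nP)); rewrite ler_pM2r ?invr_gt0// lerDr.
have [m mP mmin] := ex_minnP ex.
have dm : d <= D * lam ^+ m.
  case: m mP mmin => [_ _|m _ mmin]; first by rewrite expr0 mulr1 -lee_fin -dE.
  have : ~~ (D `^ alpha * q ^+ m.+1 <= d `^ alpha + e).
    by apply/negP => /mmin; rewrite ltnn.
  rewrite -ltNge -scaleE => h; rewrite leNgt; apply/negP => h'.
  have : (D * lam ^+ m.+1) `^ alpha < d `^ alpha.
    apply: gt0_ltr_powR; rewrite ?nnegrE//.
    by rewrite mulr_ge0 ?exprn_ge0 ?(ltW D0) ?(ltW lam0).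
  lra.
have [y Uy] : exists y, U `<=` cyl y m.
  have [->|/set0P[y Uy]] := eqVneq U set0; first by exists z.
  exists y => x Ux; apply/mdist_A; apply: le_trans dm.
  by rewrite -lee_fin -dE mdist_le_diam.
exists m, y; split => //; rewrite dE poweR_EFin -EFinD -EFinM lee_fin.
apply: (le_trans (invP_le m)).
have -> : 2 * q ^+ m = 2 / (q * D `^ alpha) * (D `^ alpha * q ^+ m.+1).
  by rewrite exprS; field; rewrite !gt_eqF.
by rewrite ler_wpM2l// divr_ge0// mulr_ge0// ltW.
Qed.

(** A cover of cost below the bound would be enlarged by [cover_cyl] to cylinders of total weight
    below [1 / P j], and [uncovered_point] finds a point that they miss. Scale 1 suffices, as the
    content is at most the measure. *)
Let hausdorff_cyl_ge z j :
  ((q * D `^ alpha / 2 / (P j)%:R)%:E <= hausdorff_measure alpha (cyl z j))%E.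
Proof.
apply: le_trans (hausdorff_content_le_measure _ _ ltr01).
apply: le_ereal_inf_tmp => _ [U [cU _] <-]; rewrite leNgt; apply/negP => lt.
set S := (\sum_(0 <= n <oo) _)%E in lt.
have S0 : (0 <= S)%E by apply: nneseries_ge0 => n _ _; exact: poweR_ge0.
set K := q * D `^ alpha / 2 / (P j)%:R in lt.
have [s sE] : exists s, S = s%:E.
  by exists (fine S); rewrite fineK// ge0_fin_numE// (lt_trans lt)// ltry.
rewrite sE lte_fin in lt.
have Da0 : 0 < D `^ alpha by exact: powR_gt0.
(* Half the gap below [K] is spread over the cover as [e / 2^(n+1)], so the total stays below
   [K]. *)
pose e := (K - s) / 2; have e0 : 0 < e by rewrite /e; lra.
have pn n : 0 < (2 ^ n.+1)%:R :> R by rewrite ltr0n expn_gt0.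
have /choice[w wP] : forall n, exists wy : nat * Z, U n `<=` cyl wy.2 wy.1 /\
  (((P wy.1)%:R^-1)%:E <= (2 / (q * D `^ alpha))%:E *
     (poweR (diam (U n)) alpha + (e / (2 ^ n.+1)%:R)%:E))%E.
  move=> n; have [m [y h]] := @cover_cyl (U n) (e / (2 ^ n.+1)%:R) z
     (divr_gt0 e0 (pn n)).
  by exists (m, y).
have [|x zx xn] := @uncovered_point (fun n => (w n).1) (fun n => (w n).2) z j.
  apply: (@le_lt_trans _ _ ((2 / (q * D `^ alpha))%:E * (S + e%:E))%E).
    apply: (@le_trans _ _ (\sum_(n <oo) ((2 / (q * D `^ alpha))%:E *
       (poweR (diam (U n)) alpha + (e / (2 ^ n.+1)%:R)%:E)))%E).
      apply: lee_nneseries => [n _ _|n _]; last exact: (wP n).2.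
      by rewrite lee_fin invr_ge0.
    rewrite nneseriesZl; last first.
      by move=> n _; rewrite adde_ge0 ?poweR_ge0// lee_fin divr_ge0// ltW.
    apply: lee_wpmul2l; first by rewrite lee_fin divr_ge0// mulr_ge0// ltW.
    by apply: epsilon_trick; [move=> n; exact: poweR_ge0|exact: ltW].
  rewrite sE -EFinD -EFinM lte_fin.
  have -> : (P j)%:R^-1 = 2 / (q * D `^ alpha) * K.
    by rewrite /K; field; rewrite !gt_eqF.
  by rewrite ltr_pM2l ?divr_gt0 ?mulr_gt0// /e; lra.
by have [n _ /(wP n).1] := cU _ zx; exact: xn.
Qed.

Lemma cantor_ahlfors_regular : ahlfors_regular alpha Z.
Proof.
split.
  (* If every [b j] were 1, [P_growth] at 2 would give [1/2 <= q^2], against [q <= 1/2]. *)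
  have [j bj] : exists j, (1 < b j)%N.
    apply: contrapT => /forallNP h.
    have b1 j : b j = 1%N.
      by apply/eqP; rewrite eqn_leq b_gt0 leqNgt andbT; apply/negP/h.
    have /andP[+ _] := P_growth 2.
    rewrite !big_ord_recr big_ord0 /= !b1 /= mul1r expr2.
    by move: q2 q0; nra.
  have [x xP] := A_surj b_gt0.
  have [y yP] : exists y, forall i, A y i = (i == j).
    by apply: A_surj => i; case: eqP => [->|].
  by exists x, y => xy; have := yP j; rewrite -xy xP eqxx.
(* These are the cylinder constants [q / 2] and 2, each worsened by one factor [q] for passing
   between consecutive orders. *)
exists (q ^+ 2 / 2), (2 / q); split.
- by rewrite divr_gt0// exprn_gt0.
- have h : 1 < q^-1 by rewrite invf_gt1.
  by move: q0 q1; rewrite expr2; nra.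
move=> z r r0 rZ.
have rD : r <= D.
  rewrite -lee_fin (le_trans rZ)//; apply: diam_le => //; exact: ltW.
have ex : exists j, D * lam ^+ j < r.
  have [n nP] := expr_small (ltW lam0) lam1 (divr_gt0 r0 D0).
  by exists n; rewrite mulrC -ltr_pdivlMr.
(* The least order is written [j.+1], so that [D * lam ^+ j.+1 < r <= D * lam ^+ j] and the ball
   lies between the cylinders of orders [j.+1] and [j]. *)
have [[|j] jr jmin] := ex_minnP ex.
  by move: jr; rewrite expr0 mulr1 ltNge rD.
have rj : r <= D * lam ^+ j.
  by rewrite leNgt; apply/negP => /jmin; rewrite ltnn.
have Da0 : 0 < D `^ alpha by exact: powR_gt0.
have ler_powRa u v : 0 <= u -> u <= v -> u `^ alpha <= v `^ alpha.
  move=> u0 uv; apply: ge0_ler_powR; rewrite ?nnegrE ?(ltW alpha0)//.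
  exact: le_trans uv.
have h1 := ler_powRa _ _ (ltW r0) rj.
have h2 : (D * lam ^+ j.+1) `^ alpha <= r `^ alpha.
  by apply: ler_powRa; rewrite ?ltW// mulr_gt0 ?exprn_gt0.
rewrite !scaleE in h1 h2.
apply/andP; split.
  apply: (@le_trans _ _ (hausdorff_measure alpha (cyl z j.+1))); last first.
    apply: hausdorff_measureS => y zy; rewrite ballEmdist /=.
    by apply: le_lt_trans jr; apply/mdist_A.
  apply: le_trans (hausdorff_cyl_ge z j.+1); rewrite lee_fin.
  apply: (@le_trans _ _ (q ^+ 2 / 2 * (D `^ alpha * q ^+ j))).
    by rewrite ler_wpM2l// divr_ge0// exprn_ge0// ltW.
  have -> : q ^+ 2 / 2 * (D `^ alpha * q ^+ j) = q * D `^ alpha / 2 * q ^+ j.+1.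
    by rewrite [q ^+ j.+1]exprS; ring.
  by rewrite ler_wpM2l// divr_ge0// mulr_ge0// ltW.
apply: (@le_trans _ _ (hausdorff_measure alpha (cyl z j))).
  apply: hausdorff_measureS => y; rewrite ballEmdist /= => zy.
  by apply/mdist_A; rewrite (le_trans (ltW zy)).
apply: (le_trans (hausdorff_cyl_le z j)); rewrite lee_fin.
apply: (@le_trans _ _ (D `^ alpha * (2 * q ^+ j))).
  by rewrite ler_wpM2l// ltW.
have -> : D `^ alpha * (2 * q ^+ j) = 2 / q * (D `^ alpha * q ^+ j.+1).
  by rewrite exprS; field; rewrite gt_eqF.
by rewrite ler_wpM2l// divr_ge0// ltW.
Qed.

End cantor.

(** * Cylinders of the boundary and coding of rays by digits *)

Section tree.
Context {R : realType} (T : rootedTree).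
Implicit Types z x : boundary R T.

Lemma mdist_le_agree z x n : (mdist z x <= 2 ^- n) <-> (ray_val z n = ray_val x n).
Proof.
rewrite -[mdist z x]/(rho z x) /rho; case: eqP => [->|zx].
  by rewrite invr_ge0 exprn_ge0.
rewrite lef_pV2 ?posrE ?exprn_gt0// ler_eXn2l ?ltr1n//.
exact: iff_sym (depth_meetP zx n).
Qed.

Lemma mdist_lt_agree z x n :
  (mdist z x < 2 ^- n) <-> (ray_val z n.+1 = ray_val x n.+1).
Proof.
rewrite -[mdist z x]/(rho z x) /rho; case: eqP => [->|zx].
  by rewrite invr_gt0 exprn_gt0.
rewrite ltf_pV2 ?posrE ?exprn_gt0// ltr_eXn2l ?ltr1n//.
exact: iff_sym (depth_meetP zx n.+1).
Qed.

(** Comparing one vertex is enough: rays with the same [n]-th vertex share all earlier ones. *)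
Definition cylinder z n := [set x : boundary R T | ray_val z n = ray_val x n].

Lemma ball_cylinder z n : ball z (2 ^- n) = cylinder z n.+1.
Proof.
by apply/seteqP; split=> x; rewrite ballEmdist /= => /mdist_lt_agree.
Qed.

(** A cylinder of level [n.+1] is a ball of radius [2 ^- n], whence the factor [2] to the power [Q].
    Taking [n0] as the level where two distinct rays part makes these radii at most the diameter. *)
Lemma ahlfors_regular_cylinder (Q : R) : ahlfors_regular Q (boundary R T) ->
  exists n0 (c C : R), [/\ 0 < c, 0 < C & forall z n, (n0 < n)%N ->
    ((c * (2 ^- n) `^ Q)%:E <= hausdorff_measure Q (cylinder z n)
      <= (C * (2 ^- n) `^ Q)%:E)%E].
Proof.
move=> [[x [y xy]] [c [C [c0 cC HcC]]]].
exists (depth (meet x y)), (c * 2 `^ Q), (C * 2 `^ Q).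
have C0 := lt_trans c0 cC.
split; [by rewrite mulr_gt0 ?powR_gt0|by rewrite mulr_gt0 ?powR_gt0|].
move=> z [//|n]; rewrite ltnS => dn.
have nQ : 2 `^ Q * (2 ^- n.+1) `^ Q = (2 ^- n) `^ Q :> R.
  rewrite -powRM ?invr_ge0 ?exprn_ge0//; congr (_ `^ _).
  by rewrite exprS; field; rewrite expf_neq0// pnatr_eq0.
rewrite -!mulrA nQ -ball_cylinder; apply: HcC; first by rewrite invr_gt0 exprn_gt0.
apply: le_trans (@mdist_le_diam _ _ setT x y I I).
rewrite -[mdist x y]/(rho x y) /rho; case: eqP => // _.
by rewrite lee_fin lef_pV2 ?posrE ?exprn_gt0// ler_eXn2l ?ltr1n.
Qed.

(** The points are picked one by one: fewer than [M] cylinders of level [n + k] have too little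
    measure to cover one of level [n]. *)
Lemma cylinder_branching (Q c C : R) n0 k M : 0 < Q -> 0 < C ->
  (forall z n, (n0 < n)%N ->
    ((c * (2 ^- n) `^ Q)%:E <= hausdorff_measure Q (cylinder z n)
      <= (C * (2 ^- n) `^ Q)%:E)%E) ->
  M%:R * C * (2 ^- k) `^ Q <= c ->
  forall z n, (n0 < n)%N -> exists g : nat -> boundary R T,
    (forall i, (i < M)%N -> cylinder z n (g i)) /\
    (forall i j, (i < j < M)%N -> ~ cylinder (g i) (n + k) (g j)).
Proof.
move=> Q0 C0 HcC Mk z n n0n.
suff: forall m, (m <= M)%N -> exists g : nat -> boundary R T,
    (forall i, (i < m)%N -> cylinder z n (g i)) /\
    (forall i j, (i < j < m)%N -> ~ cylinder (g i) (n + k) (g j)).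
  by move=> /(_ M); apply.
elim=> [_|m IH mM]; first by exists (fun=> z); split => // i j; rewrite ltn0 andbF.
have [g [gz gg]] := IH (ltnW mM).
have [x zx xg] : exists2 x, cylinder z n x &
    forall i, (i < m)%N -> ~ cylinder (g i) (n + k) x.
  apply: contrapT => /forall2NP H.
  have sub : cylinder z n `<=` \bigcup_(i < m) cylinder (g i) (n + k).
    move=> x zx; have [//|/existsNP[i /not_implyP[im /contrapT gx]]] := H x.
    by exists i.
  have /andP[+ _] := HcC z n n0n; apply/negP; rewrite -ltNge.
  apply: (le_lt_trans (hausdorff_measureS _ sub)).
  apply: (@le_lt_trans _ _ (m%:R * (C * (2 ^- (n + k)) `^ Q))%:E).
    apply: bigcup_subadditive_le => [||i im].
    - exact: hausdorff_measure0.
    - exact: hausdorff_measureU.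
    - by have /andP[] := HcC (g i) (n + k)%N (leq_trans n0n (leq_addr _ _)).
  have p0 j : 0 < ((2 ^- j) `^ Q : R) by rewrite powR_gt0// invr_gt0 exprn_gt0.
  rewrite lte_fin exprD invfM powRM ?invr_ge0 ?exprn_ge0//.
  rewrite (mulrC (_ `^ Q) (_ `^ Q)) !mulrA ltr_pM2r//.
  by apply: lt_le_trans Mk; rewrite !ltr_pM2r// ltr_nat.
exists (fun i => if (i < m)%N then g i else x); split => [i|i j /andP[ij]].
  by rewrite ltnS => im; case: ifP => // im'; exact: gz.
rewrite ltnS => jm; rewrite (leq_trans ij jm); case: ifP => jm'.
  by apply: gg; rewrite ij.
exact/xg/(leq_trans ij).
Qed.

(** The limit is the diagonal [u n n]; each finite part of it lies on a single ray [u N], which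
    supplies its edges and their distinctness. *)
Lemma ray_limit (u : nat -> ray T) : (forall n, u n.+1 n = u n n) ->
  exists z : ray T, forall m n, (m <= n)%N -> z m = u n m.
Proof.
move=> uS; have uE m n : (m <= n)%N -> u m m = u n m.
  move=> /subnKC <-; elim: (n - m)%N => [|d IH]; first by rewrite addn0.
  by rewrite IH addnS (ray_agree (uS _))// leq_addr.
have u0 : u 0%N 0%N = tree_root T by exact: ray0.
have ue n : edge (u n n) (u n.+1 n.+1) by rewrite (uE n n.+1)// ray_edge.
have ui : injective (fun n => [set u n n; u n.+1 n.+1]).
  move=> m n /=; set N := (maxn m n).+1.
  rewrite (uE m N) ?(uE m.+1 N) ?(uE n N) ?(uE n.+1 N) /N ?ltnS ?leq_maxl ?leq_maxr
    ?(leqW (leq_maxl _ _)) ?(leqW (leq_maxr _ _))//.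
  exact: (@ray_inj T (u N)).
by exists (@Ray T (fun n => u n n) u0 ue ui).
Qed.

End tree.

(* Points of Y are coded by digit sequences: the j-th digit selects one of the
   separated cylinders of level n1 + (j+1) k inside the current cylinder of level
   n1 + j k. *)
Lemma digit_embedding (R : realType) (T : rootedTree) (n1 k M : nat)
    (z0 : boundary R T) (f : boundary R T * nat -> nat -> boundary R T)
    (b : nat -> nat) : (0 < k)%N -> (forall j, b j <= M)%N ->
  (forall zn, (n1 <= zn.2)%N ->
    (forall i, (i < M)%N -> cylinder zn.1 zn.2 (f zn i)) /\
    (forall i j, (i < j < M)%N -> ~ cylinder (f zn i) (zn.2 + k) (f zn j))) ->
  exists X : (nat -> nat) -> boundary R T, forall s t,
    (forall j, s j < b j)%N -> (forall j, t j < b j)%N -> forall j,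
    ray_val (X s) (n1 + j * k) = ray_val (X t) (n1 + j * k) <->
    (forall i, (i < j)%N -> s i = t i).
Proof.
move=> k0 bM fP; pose l j := (n1 + j * k)%N.
have lS j : l j.+1 = (l j + k)%N by rewrite /l mulSn addnCA addnC.
(* Since [k > 0] the levels reach every depth, so the approximations [G s j] stabilise as
   [ray_limit] requires. *)
have l_ge j : (j <= l j)%N.
  by rewrite (leq_trans _ (leq_addl _ _))// leq_pmulr.
pose G (s : nat -> nat) :=
  fix G j := if j is j'.+1 then f (G j', l j') (s j') else z0.
have fl j z := fP (z, l j) (leq_addr _ _).
have /choice[X XP] : forall s, exists z : boundary R T, (forall j, s j < b j)%N ->
    forall j, ray_val z (l j) = ray_val (G s j) (l j).
  move=> s; have [sb|] := pselect (forall j, s j < b j)%N; last by exists z0.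
  have GS j : ray_val (G s j.+1) (l j) = ray_val (G s j) (l j).
    by rewrite -((fl j (G s j)).1 (s j))//; exact: leq_trans (sb j) (bM j).
  have GE j d : ray_val (G s (j + d)%N) (l j) = ray_val (G s j) (l j).
    elim: d => [|d <-]; first by rewrite addn0.
    rewrite addnS (ray_agree (GS _))// /l leq_add2l leq_mul2r.
    by rewrite leq_addr orbT.
  have [|z zP] := @ray_limit T (G s).
    by move=> n; rewrite (ray_agree (GS n)).
  exists z => _ j; rewrite (zP (l j) (l j))//.
  by rewrite -(GE j (l j - j)%N) subnKC.
exists X => s t sb tb; rewrite -/(l _) => j.
have Gst j' : (forall i, (i < j')%N -> s i = t i) -> G s j' = G t j'.
  elim: j' => //= j' IH st; rewrite st// IH// => i ij.
  by apply: st; rewrite ltnW.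
split; last by move=> st; rewrite -/(l j) !XP// Gst.
elim: j => // j IH; rewrite -/(l j.+1) => E.
have lj : (l j <= l j.+1)%N by rewrite lS leq_addr.
have st := IH (ray_agree E lj).
move=> i; rewrite ltnS leq_eqVlt => /predU1P[->|]; last exact: st.
have sM : (s j < M)%N := leq_trans (sb j) (bM j).
have tM : (t j < M)%N := leq_trans (tb j) (bM j).
move: E; rewrite !XP//= (Gst _ st) lS => E.
have [_ ff] := fl j (G t j).
(* Different [j]-th digits select separated cylinders of level [l j + k] in the same parent, so the
   rays could not agree there. *)
case: (ltngtP (s j) (t j)) => // lt; exfalso.
  by apply: (ff (s j) (t j)); rewrite ?lt.
by apply: (ff (t j) (s j)); rewrite ?lt//; exact: esym.
Qed.

(** * Choice of the scale and assembly of the Cantor set *)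

Unset Implicit Arguments.

Theorem theorem1p4 (R : realType) (Q alpha : R) (T : rootedTree) :
  0 < Q ->
  (exists x y : T, edge x y) ->
  (forall x : T, x <> tree_root T ->
     exists y z : T, [/\ y <> z, edge x y & edge x z]) ->
  ahlfors_regular Q (boundary R T) ->
  0 < alpha -> alpha < Q ->
  exists Y : set (boundary R T), ahlfors_regular alpha (set_type Y).
Proof.
move=> Q0 _ _ QT alpha0 alphaQ.
have [n0 [c [C [c0 C0 HcC]]]] := ahlfors_regular_cylinder QT.
have [[z0 _] _] := QT.
have x1 (e : R) : 0 < e -> 2 `^ (- e) < 1.
  move=> e0; rewrite powRN invf_lt1 ?powR_gt0//.
  rewrite -[ltLHS]/((fun=> 1 : R) e) -powR1.
  by apply: gt0_ltr_powR; rewrite ?nnegrE// ltr1n.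
have half0 : 0 < 2^-1 :> R by rewrite invr_gt0.
(* [k1] ensures [q <= 1/2], as [homogeneous_digits] requires; [k2] uses [alpha < Q] to make room for
   [M] separated cylinders [k] levels down. *)
have [k1 k1P] := expr_small (powR_ge0 2 (- alpha)) (x1 _ alpha0) half0.
have cC0 : 0 < c / (2 * C) by rewrite divr_gt0// mulr_gt0.
have Qa0 : 0 < Q - alpha by rewrite subr_gt0.
have [k2 k2P] := expr_small (powR_ge0 2 (- (Q - alpha))) (x1 _ Qa0) cC0.
pose k := maxn k1 k2.
have kP1 : (2 `^ (- alpha)) ^+ k <= 2^-1 :> R.
  apply: le_trans (ltW k1P); rewrite ler_wiXn2l ?powR_ge0 ?(ltW (x1 _ _))//.
  exact: leq_maxl.
have kP2 : (2 `^ (- (Q - alpha))) ^+ k <= c / (2 * C).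
  apply: le_trans (ltW k2P); rewrite ler_wiXn2l ?powR_ge0 ?(ltW (x1 _ _))//.
  exact: leq_maxr.
have k0 : (0 < k)%N.
  by rewrite lt0n; apply/eqP => k0; move: kP1; rewrite k0 expr0; lra.
have powk e : (2 ^- k) `^ e = (2 `^ (- e)) ^+ k :> R by exact: powR_invX.
pose lam : R := 2 ^- k; pose q := lam `^ alpha.
have lam0 : 0 < lam by rewrite invr_gt0 exprn_gt0.
have lam1 : lam < 1 by rewrite invf_lt1 ?exprn_gt0// exprn_egt1 ?ltr1n// -lt0n.
have q0 : 0 < q by exact: powR_gt0.
have q2 : q <= 2^-1 by rewrite /q /lam powk.
have [b bP] := homogeneous_digits q0 q2.
(* A bound for all [b j] at once, so that one branching number serves every level. *)
pose M := Num.truncn (2 / q).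
have bM j : (b j <= M)%N.
  by have [_ bq _] := bP j; rewrite /M truncn_ge_nat// divr_ge0// ltW.
(* By the choice of [k2], the left side is at most [(2 / q) C q c / (2 C) = c]. *)
have MC : M%:R * C * (2 ^- k) `^ Q <= c.
  have Mq : M%:R <= 2 / q.
    have q20 : 0 <= 2 / q by rewrite divr_ge0// ltW.
    by have /andP[] := truncn_itv q20.
  have -> : (2 ^- k) `^ Q = q * (2 `^ (- (Q - alpha))) ^+ k.
    rewrite -powk -powRD; first by rewrite subrKC.
    by rewrite subrKC gt_eqF.
  set w := (X in q * X); have w0 : 0 <= w by rewrite exprn_ge0// powR_ge0.
  apply: (@le_trans _ _ (2 / q * C * (q * (c / (2 * C))))).
    apply: ler_pM.
    - by rewrite mulr_ge0// ltW.
    - by rewrite mulr_ge0// ltW.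
    - by rewrite ler_pM2r.
    - by rewrite ler_pM2l.
  by rewrite le_eqVlt; apply/orP; left; apply/eqP; field; rewrite !gt_eqF.
have /choice[f fP] : forall zn : boundary R T * nat,
    exists g : nat -> boundary R T, (n0.+1 <= zn.2)%N ->
    (forall i, (i < M)%N -> cylinder zn.1 zn.2 (g i)) /\
    (forall i j, (i < j < M)%N -> ~ cylinder (g i) (zn.2 + k) (g j)).
  move=> [z n]; have [n0n|] := ltnP n0 n; last by exists (fun=> z).
  by have [g gP] := cylinder_branching Q0 C0 HcC MC z n0n; exists g.
have [X XP] := digit_embedding z0 k0 bM fP.
pose Y := [set X s | s in [set s | forall j, (s j < b j)%N]].
exists Y.
(* [A] picks an admissible code of each point; [XP] at [j.+1] shows that the digit [j] does not
   depend on the choice. *)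
have /choice[A AP] : forall y : set_type Y, exists s,
    (forall j, (s j < b j)%N) /\ X s = set_val y.
  by move=> y; have [s sb Xs] := set_valP y; exists s.
(* All of [Y] lies in one cylinder of level [n0.+1], the first level with branching, which fixes the
   scale [D]. *)
have D0 : 0 < 2 ^- n0.+1 :> R by rewrite invr_gt0 exprn_gt0.
apply: (cantor_ahlfors_regular (A := A) alpha0 D0 lam0 lam1 erefl q2).
- by move=> z j; exact: (AP z).1.
- move=> s sb; have Ys : Y (X s) by exists s.
  exists (SigSub (mem_set Ys)) => j.
  have [ab aX] := AP (SigSub (mem_set Ys)).
  by apply: (XP _ _ ab sb j.+1).1; rewrite ?aX.
- move=> x y j; have -> : 2 ^- n0.+1 * lam ^+ j = 2 ^- (n0.+1 + j * k) :> R.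
    by rewrite /lam exprD invfM mulnC exprM exprVn.
  rewrite -[mdist x y]/(mdist (set_val x) (set_val y)).
  apply: (iff_trans (mdist_le_agree _ _ _)).
  by rewrite -(AP x).2 -(AP y).2; exact: XP (AP x).1 (AP y).1 j.
- by move=> j; have [] := bP j.
Qed.
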